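(* Let a group $H$ act on a set $X$, and assume that the action $H\curvearrowright X$ is amenable. Let $Z$ be any non-trivial group and let $G=Z\wr_X H$ be the corresponding restricted wreath product group. If all orbits of $H\curvearrowright X$ are infinite, then $H$ is non-trivially inner amenable relative to $G$, that is, $H$ is inner amenable relative to $G$ and the set $\{hgh^{-1}:h\in H\}$ is infinite for every $g\in G\smallsetminus H$.
   Context: Groups are discrete. An action $H\curvearrowright X$ of a group on a set is amenable if there exists an $H$-invariant state on $\ell^\infty(X)$ (equivalently, an $H$-invariant mean, i.e. finitely additive probability measure, on all subsets of $X$); no freeness or transitivity is required. For a pair of groups $H\subset G$, $H$ is inner amenable relative to $G$ if $H$ is a proper subgroup of $G$ and there exists a state on $\ell^\infty(G\smallsetminus H)$ invariant under the action of $H$ on $G\smallsetminus H$ by conjugation. $H$ is trivially inner amenable relative to $G$ if there exists $g\in G\smallsetminus H$ such that $\{hgh^{-1}:h\in H\}$ is finite; non-trivially inner amenable means inner amenable relative to $G$ but not trivially so. Restricted wreath product: $Z^{(X)}$ is the group (under pointwise multiplication) of all functions $a:X\to Z$ such that $\{x\in X: a(x)\neq 1\}$ is finite. $H$ acts on it by $\sigma_g(a)(x)=a(g^{-1}x)$, and $Z\wr_X H=Z^{(X)}\rtimes_\sigma H$, i.e. the set $Z^{(X)}\times H$ with $(a_1,g_1)(a_2,g_2)=(a_1\sigma_{g_1}(a_2),g_1g_2)$; $H$ is identified with $\{1\}\times H$. *)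

(* Defs.v *)
From HB Require Import structures.
From mathcomp Require Import all_boot all_order all_algebra.
From mathcomp Require Import all_classical all_reals all_analysis.
From mathcomp Require Import complex.

Set Implicit Arguments.
Unset Strict Implicit.
Unset Printing Implicit Defensive.

Import Order.TTheory GRing.Theory Num.Theory.
Import numFieldNormedType.Exports.

Local Open Scope classical_set_scope.
Local Open Scope ring_scope.

Section Linfty.
Variables (R : realType) (X : Type).

Lemma bounded_funP (f : X -> R[i]^o) :
  bounded_fun f <-> exists M : R[i], forall x, `|f x| <= M.
Proof.
have [X0|/forallNP X0] := pselect (exists x : X, True); last first.
  split=> _; first by exists 0 => x; case: (X0 x).
  by exists 0; split=> [|M _ x]; [exact: real0|case: (X0 x)].
have PF : ProperFilter (globally [set: X]).
  by case: X0 => x _; apply: (@globally_properfilter _ _ x).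
rewrite /= ex_bound; split=> -[M hM]; exists M => x.
  exact: hM.
by move=> _; apply: hM.
Qed.

(* Scalars are complex: on [R[i]], [0 <= z] means that [z] is real and
   nonnegative, so the positivity condition in [is_state] is the usual one. *)
Record linfty := Linfty {
  linfty_val :> X -> R[i]^o;
  _ : `[< bounded_fun linfty_val >] }.

HB.instance Definition _ := [isSub for linfty_val].
HB.instance Definition _ := [Choice of linfty by <:].

Fact linfty_submod_closed :
  submod_closed [pred f : X -> R[i]^o | `[< bounded_fun f >]].
Proof.
split=> [|a f g]; rewrite !inE.
  by apply/bounded_funP; exists 0 => x; rewrite normr0.
move=> /bounded_funP[M hM] /bounded_funP[N hN].
apply/bounded_funP; exists (`|a| * M + N) => x.
rewrite (le_trans (ler_normD _ _))// lerD ?hN// normrM.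
by rewrite ler_wpM2l// hM.
Qed.

HB.instance Definition _ :=
  GRing.SubChoice_isSubLmodule.Build R[i] (X -> R[i]^o) _ linfty
    linfty_submod_closed.

Fact linfty_one_subproof : `[< bounded_fun ((fun=> 1) : X -> R[i]^o) >].
Proof. by apply/asboolP/bounded_funP; exists 1 => x; rewrite normr1. Qed.

Definition linfty_one : linfty := Linfty linfty_one_subproof.

Definition is_state (phi : {scalar linfty}) : Prop :=
  (forall f : linfty, (forall x, 0 <= f x) -> 0 <= phi f) /\
  phi linfty_one = 1.

End Linfty.

Fact linfty_comp_subproof (R : realType) (X Y : Type) (t : X -> Y)
  (f : linfty R Y) : `[< bounded_fun (f \o t : X -> R[i]^o) >].
Proof.
apply/asboolP/bounded_funP.
case: f => f /= /asboolP/bounded_funP[M hM].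
by exists M => x; apply: hM.
Qed.

Definition linfty_comp (R : realType) (X Y : Type) (t : X -> Y)
    (f : linfty R Y) : linfty R X :=
  Linfty (linfty_comp_subproof t f).

Definition state_invariant (R : realType) (X : Type) (t : X -> X)
    (phi : {scalar linfty R X}) : Prop :=
  forall f : linfty R X, phi (linfty_comp t f) = phi f.

Local Open Scope group_scope.

Record group_action (H : groupType) (X : Type) := GroupAction {
  gact :> H -> X -> X;
  gact1 : forall x, gact 1 x = x;
  gactM : forall g h x, gact (g * h) x = gact g (gact h x) }.

Definition gorbit (H : groupType) (X : Type) (act : group_action H X) (x : X) :
  set X := range (fun h => act h x).

Definition amenable_action (R : realType) (H : groupType) (X : Type)
    (act : group_action H X) : Prop :=
  exists phi : {scalar linfty R X},
    is_state phi /\ forall h : H, state_invariant (act h) phi.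

Section RelativeInnerAmenability.
Variables (R : realType) (G : groupType) (H : groupClosed G).

Definition group_compl : Type := {g : G | g \notin H}.

Fact conj_compl_subproof (h : {h : G | h \in H}) (g : group_compl) :
  val h * val g * (val h)^-1 \notin H.
Proof.
by case: h g => h hH [g gH] /=; rewrite gpredMr ?gpredV// gpredMl.
Qed.

Definition conj_compl (h : {h : G | h \in H}) (g : group_compl) : group_compl :=
  exist _ (val h * val g * (val h)^-1) (conj_compl_subproof h g).

Definition conj_orbit (g : G) : set G :=
  [set h * g * h^-1 | h in [set h | h \in H]].

Definition inner_amenable_rel : Prop :=
  (exists g : G, g \notin H) /\
  exists phi : {scalar linfty R group_compl},
    is_state phi /\
    forall h : {h : G | h \in H}, state_invariant (conj_compl h) phi.

Definition trivially_inner_amenable_rel : Prop :=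
  exists g : G, g \notin H /\ finite_set (conj_orbit g).

Definition nontrivially_inner_amenable_rel : Prop :=
  inner_amenable_rel /\ ~ trivially_inner_amenable_rel.

End RelativeInnerAmenability.

Section RestrictedPower.
Variables (X : Type) (Z : groupType).

Definition gsupport (a : X -> Z) : set X := [set x | a x <> 1].

Record restr_pow := RestrPow {
  restr_pow_val :> X -> Z;
  _ : `[< finite_set (gsupport restr_pow_val) >] }.

HB.instance Definition _ := [isSub for restr_pow_val].
HB.instance Definition _ := [Choice of restr_pow by <:].

Lemma restr_powP (a : restr_pow) : finite_set (gsupport a).
Proof. by case: a => a /= /asboolP. Qed.

Lemma restr_pow_eq (a b : restr_pow) : a =1 b -> a = b.
Proof. by move=> ab; apply/val_inj/funext. Qed.

Fact restr_pow_one_subproof : `[< finite_set (gsupport (fun=> 1)) >].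
Proof.
by apply/asboolP/(sub_finite_set _ (@finite_set0 X)) => x; rewrite /gsupport /=.
Qed.

Fact restr_pow_mul_subproof (a b : restr_pow) :
  `[< finite_set (gsupport (fun x => a x * b x)) >].
Proof.
apply/asboolP.
apply: (@sub_finite_set _ _ (gsupport a `|` gsupport b)); last first.
  by rewrite finite_setU; split; apply: restr_powP.
move=> x /= abx; have [ax|] := eqVneq (a x) 1; last by move/eqP; left.
by right; rewrite /gsupport/= => bx; apply: abx; rewrite ax bx mulg1.
Qed.

Fact restr_pow_inv_subproof (a : restr_pow) :
  `[< finite_set (gsupport (fun x => (a x)^-1)) >].
Proof.
apply/asboolP/(sub_finite_set _ (restr_powP a)) => x /= ax ax1.
by apply: ax; rewrite ax1 invg1.
Qed.

Definition restr_pow_one := RestrPow restr_pow_one_subproof.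
Definition restr_pow_mul a b := RestrPow (restr_pow_mul_subproof a b).
Definition restr_pow_inv a := RestrPow (restr_pow_inv_subproof a).

Fact restr_pow_mulA : associative restr_pow_mul.
Proof. by move=> a b c; apply: restr_pow_eq => x /=; rewrite mulgA. Qed.
Fact restr_pow_mul1g : left_id restr_pow_one restr_pow_mul.
Proof. by move=> a; apply: restr_pow_eq => x /=; rewrite mul1g. Qed.
Fact restr_pow_mulg1 : right_id restr_pow_one restr_pow_mul.
Proof. by move=> a; apply: restr_pow_eq => x /=; rewrite mulg1. Qed.
Fact restr_pow_mulVg : left_inverse restr_pow_one restr_pow_inv restr_pow_mul.
Proof. by move=> a; apply: restr_pow_eq => x /=; rewrite mulVg. Qed.
Fact restr_pow_mulgV : right_inverse restr_pow_one restr_pow_inv restr_pow_mul.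
Proof. by move=> a; apply: restr_pow_eq => x /=; rewrite mulgV. Qed.

HB.instance Definition _ := isGroup.Build restr_pow
  restr_pow_mulA restr_pow_mul1g restr_pow_mulg1 restr_pow_mulVg restr_pow_mulgV.

End RestrictedPower.

(* The carrier is that of [restr_pow X Z * H]; the parameter [act] is phantom and
   lets the group structure, which depends on the action, be inferred. *)
Record wreath (Z H : groupType) (X : Type) (act : group_action H X) := Wreath {
  wreath_base : restr_pow X Z;
  wreath_top : H }.

Section Wreath.
Variables (Z H : groupType) (X : Type) (act : group_action H X).

Local Notation ZX := (restr_pow X Z).

Fact base_shift_subproof (g : H) (a : ZX) :
  `[< finite_set (gsupport (fun x => a (act g^-1 x))) >].
Proof.
apply/asboolP; apply: (@sub_finite_set _ _ (act g @` gsupport a)).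
  by move=> x ax; exists (act g^-1 x) => //; rewrite -gactM mulgV gact1.
exact/finite_image/restr_powP.
Qed.

Definition base_shift (g : H) (a : ZX) : ZX := RestrPow (base_shift_subproof g a).

Lemma base_shift1 a : base_shift 1 a = a.
Proof. by apply: restr_pow_eq => x /=; rewrite invg1 gact1. Qed.

Lemma base_shiftM g h a : base_shift (g * h) a = base_shift g (base_shift h a).
Proof. by apply: restr_pow_eq => x /=; rewrite invgM gactM. Qed.

Lemma base_shift_mul g a b : base_shift g (a * b) = base_shift g a * base_shift g b.
Proof. exact: restr_pow_eq. Qed.

Lemma base_shift_one g : base_shift g 1 = 1.
Proof. exact: restr_pow_eq. Qed.

Local Notation wreath := (wreath Z act).
Local Notation Wreath := (@Wreath Z H X act).

Definition wreath_pair (w : wreath) : ZX * H := (wreath_base w, wreath_top w).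
Definition pair_wreath (p : ZX * H) : wreath := Wreath p.1 p.2.

Fact wreath_pairK : cancel wreath_pair pair_wreath. Proof. by case. Qed.

HB.instance Definition _ := Choice.copy wreath (can_type wreath_pairK).

Definition wreath_one : wreath := Wreath 1 1.
Definition wreath_mul (u v : wreath) : wreath :=
  Wreath (wreath_base u * base_shift (wreath_top u) (wreath_base v))
         (wreath_top u * wreath_top v).
Definition wreath_inv (u : wreath) : wreath :=
  Wreath (base_shift (wreath_top u)^-1 (wreath_base u)^-1) (wreath_top u)^-1.

Fact wreath_mulA : associative wreath_mul.
Proof.
by move=> [a g] [b h] [c k]; rewrite /wreath_mul/= base_shift_mul base_shiftM !mulgA.
Qed.
Fact wreath_mul1g : left_id wreath_one wreath_mul.
Proof. by move=> [a g]; rewrite /wreath_mul/= base_shift1 !mul1g. Qed.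
Fact wreath_mulg1 : right_id wreath_one wreath_mul.
Proof. by move=> [a g]; rewrite /wreath_mul/= base_shift_one !mulg1. Qed.
Fact wreath_mulVg : left_inverse wreath_one wreath_inv wreath_mul.
Proof.
move=> [a g]; rewrite /wreath_mul/= -base_shift_mul !mulVg.
by rewrite base_shift_one.
Qed.
Fact wreath_mulgV : right_inverse wreath_one wreath_inv wreath_mul.
Proof. by move=> [a g]; rewrite /wreath_mul/= -base_shiftM !mulgV base_shift1 mulgV. Qed.

HB.instance Definition _ := isGroup.Build wreath
  wreath_mulA wreath_mul1g wreath_mulg1 wreath_mulVg wreath_mulgV.

(* [H] viewed inside the wreath product as {1} x H. *)
Definition wreath_acting : {pred wreath} := [pred w | wreath_base w == 1].

Fact wreath_actingM : mulg_closed wreath_acting.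
Proof.
move=> u v /eqP u1 /eqP v1; apply/eqP.
by rewrite -[LHS]/(wreath_base u * base_shift _ (wreath_base v)) u1 v1 base_shift_one mulg1.
Qed.
Fact wreath_acting1 : 1 \in wreath_acting. Proof. by rewrite inE. Qed.
Fact wreath_actingV : invg_closed wreath_acting.
Proof.
move=> u /eqP u1; apply/eqP.
by rewrite -[LHS]/(base_shift _ (wreath_base u)^-1) u1 invg1 base_shift_one.
Qed.

HB.instance Definition _ := isMulClosed.Build wreath wreath_acting wreath_actingM.
HB.instance Definition _ := isMul1Closed.Build wreath wreath_acting wreath_acting1.
HB.instance Definition _ := isInvClosed.Build wreath wreath_acting wreath_actingV.

End Wreath.

Arguments wreath_acting Z {H X} act _.

(* Main.v *)
Require Import Defs.
From HB Require Import structures.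
From mathcomp Require Import all_boot all_order all_algebra.
From mathcomp Require Import all_classical all_reals all_analysis.
From mathcomp Require Import complex.

(** Fix [z <> 1] in [Z] and send [x : X] to the function worth [z] at [x] and
    [1] elsewhere, seen in the wreath product. This map takes its values outside
    [H] and turns the action of [H] on [X] into conjugation by [H]
    ([wreath_conj], [base_shift_single]), so an invariant mean on [X] pushes
    forward to a conjugation-invariant mean on the complement of [H]: this is
    inner amenability ([wreath_inner_amenable]). A mean exists only on a nonempty
    set, which provides an element outside [H].

    For the infinite conjugacy orbits, let [g = (a, k)] with [a x <> 1].
    Conjugating by [h] moves the base component to [base_shift h a], whose
    support contains [act h x]. If [g] had finitely many conjugates under [H],
    the union of the supports of their base components would be a finite set
    containing the orbit of [x] ([wreath_infinite_conj_orbit]). *)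

Set Implicit Arguments.
Unset Strict Implicit.

Local Open Scope classical_set_scope.
Local Open Scope group_scope.

Section Pushforward.
Variables (R : realType) (X Y : Type) (t : X -> Y).

Fact linfty_comp_is_linear : linear (@linfty_comp R X Y t).
Proof. by move=> c f g; apply/val_inj/funext. Qed.

HB.instance Definition _ :=
  GRing.isLinear.Build R[i] (linfty R Y) (linfty R X) *:%R%R (linfty_comp t)
    linfty_comp_is_linear.

Definition pushforward (phi : {scalar linfty R X}) : {scalar linfty R Y} :=
  phi \o linfty_comp t.

Lemma pushforward_state (phi : {scalar linfty R X}) :
  is_state phi -> is_state (pushforward phi).
Proof.
move=> [phi_ge0 phi1]; split=> [f f_ge0|].
  by apply: phi_ge0 => x; apply: f_ge0.
by rewrite -phi1 /=; congr (phi _); apply: val_inj.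
Qed.

Lemma pushforward_invariant (u : X -> X) (v : Y -> Y)
    (phi : {scalar linfty R X}) :
    (forall x, v (t x) = t (u x)) ->
  state_invariant u phi -> state_invariant v (pushforward phi).
Proof.
move=> tuv phi_inv f; rewrite /= -[RHS]phi_inv; congr (phi _).
by apply/val_inj/funext => x /=; rewrite tuv.
Qed.

End Pushforward.

(** On the empty set the constant [1] is the zero function, on which a linear
    form cannot take the value [1]. *)
Lemma state_inhabited (R : realType) (X : Type) (phi : {scalar linfty R X}) :
  is_state phi -> exists x : X, True.
Proof.
move=> [_ phi1]; apply: contrapT => /forallNP X0.
have one0 : linfty_one R X = 0%R.
  by apply/val_inj/funext => x; case: (X0 x).
by move/eqP: phi1; rewrite one0 GRing.raddf0 eq_sym GRing.oner_eq0.
Qed.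

Section SingleSupport.
Variables (X : Type) (Z : groupType) (z : Z).

Fact single_subproof (x : X) :
  `[< finite_set (gsupport (fun y => if `[< y = x >] then z else 1)) >].
Proof.
apply/asboolP/(sub_finite_set _ (finite_set1 x)) => y /=.
by rewrite /gsupport /=; case: asboolP.
Qed.

Definition single (x : X) : restr_pow X Z := RestrPow (single_subproof x).

Lemma single_neq1 (x : X) : z <> 1 -> single x != 1.
Proof.
move=> z1; apply/eqP => /(congr1 (fun a : restr_pow X Z => a x)) /=.
by case: asboolP.
Qed.

(** Both sides are supported at [act h x]; this equivariance is what transfers
    invariance under the action to invariance under conjugation. *)
Lemma base_shift_single (H : groupType) (act : group_action H X) (h : H)
  (x : X) : base_shift act h (single x) = single (act h x).
Proof.
apply: restr_pow_eq => y /=; congr (if _ then _ else _).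
apply/asbool_equiv_eq; split=> [<-|->]; first by rewrite -gactM mulgV gact1.
by rewrite -gactM mulVg gact1.
Qed.

End SingleSupport.

Section Wreath.
Variables (Z H : groupType) (X : Type) (act : group_action H X).

Lemma wreath_conj (h : H) (w : wreath Z act) :
  (Wreath act 1 h : wreath Z act) * w * (Wreath act 1 h)^-1 =
  Wreath act (base_shift act h (wreath_base w)) (h * wreath_top w * h^-1).
Proof.
case: w => a k; rewrite -[LHS]/(wreath_mul (wreath_mul _ _) (wreath_inv _)).
by rewrite /wreath_mul /wreath_inv /= invg1 !base_shift_one mul1g mulg1.
Qed.

Lemma wreath_actingP (w : wreath Z act) :
  w \in wreath_acting Z act -> w = Wreath act 1 (wreath_top w).
Proof. by case: w => a k /eqP /= ->. Qed.

(** The pushforward of an invariant mean along [x |-> (single z x, 1)]: the top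
    component is [1], so conjugation by [H] fixes it and only shifts the base. *)
Lemma wreath_inner_amenable (R : realType) :
    amenable_action R act -> (exists z : Z, z <> 1) ->
  inner_amenable_rel R (wreath_acting Z act).
Proof.
move=> [phi [phi_state phi_inv]] [z z1].
have single_out x : Wreath act (single z x) 1 \notin wreath_acting Z act.
  by rewrite inE /= single_neq1.
split.
  by have [x _] := state_inhabited phi_state; exists (Wreath act (single z x) 1).
pose t x : group_compl (wreath_acting Z act) :=
  exist (fun g => is_true (g \notin _)) _ (single_out x).
exists (pushforward t phi); split; first exact: pushforward_state.
move=> [h hH]; apply: (@pushforward_invariant _ _ _ _ (act (wreath_top h))) => //.
move=> x; apply: val_inj => /=.
by rewrite (wreath_actingP hH) wreath_conj /= base_shift_single mulg1 mulgV.
Qed.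

(** The supports of the conjugates of [g] together cover the orbit of any point in
    the support of [g], and each of them is finite. *)
Lemma wreath_infinite_conj_orbit (g : wreath Z act) :
    (forall x : X, infinite_set (gorbit act x)) ->
    g \notin wreath_acting Z act ->
  infinite_set (conj_orbit (wreath_acting Z act) g).
Proof.
move=> orb_inf gH conj_fin.
have [x ax1] : exists x, wreath_base g x <> 1.
  apply: contrapT => /forallNP a1; move/eqP: gH; apply.
  by apply/restr_pow_eq => x; apply: contrapT; apply: a1.
apply: (orb_inf x); apply: (@sub_finite_set _ _
  (\bigcup_(w in conj_orbit (wreath_acting Z act) g) gsupport (wreath_base w))).
- move=> _ [h _ <-].
  exists ((Wreath act 1 h : wreath Z act) * g * (Wreath act 1 h)^-1).
    by exists (Wreath act 1 h) => //=; rewrite inE.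
  by rewrite wreath_conj /gsupport /= -gactM mulVg gact1.
- by apply: bigcup_finite => // w _; apply: restr_powP.
Qed.

End Wreath.

Unset Implicit Arguments.
Set Strict Implicit.

Theorem theoremB (R : realType) (H : groupType) (X : Type)
    (act : group_action H X) (Z : groupType)
    (act_amenable : amenable_action R act)
    (Z_nontrivial : exists z : Z, z <> 1)
    (infinite_orbits : forall x : X, infinite_set (gorbit act x)) :
  nontrivially_inner_amenable_rel R (wreath_acting Z act) /\
  (inner_amenable_rel R (wreath_acting Z act) /\
   forall g : wreath Z act, g \notin wreath_acting Z act ->
     infinite_set (conj_orbit (wreath_acting Z act) g)).
Proof.
have amen := wreath_inner_amenable act_amenable Z_nontrivial.
have orb_inf g := wreath_infinite_conj_orbit (Z := Z) (g := g) infinite_orbits.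
by do 2![split=> //]; move=> [g [gH]]; apply: orb_inf.
Qed.
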